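(* Let $\mathbb{D}\in\{\mathbb{R},\mathbb{C},\mathbb{H}\}$, let $\sigma$ be a Kubo-Ando mean on $\mathscr{P}_n(\mathbb{D})$ with representing function $f$, and let $A,B\in\mathscr{P}_n(\mathbb{D})$ be such that $|\mathrm{Spec}(A^{-1}B)|=r$, with $\mathrm{Spec}(A^{-1}B)=\{\lambda_1,\dots,\lambda_r\}$. Then $$A\,\sigma\,B=c_0A+\sum_{k=1}^{r-1}c_k\,(BA^{-1})^{k-1}B,$$ where the coefficients $c_k$ depend only on $f$ and the eigenvalues of $A^{-1}B$, and are given by $$c_k=(-1)^{r-1-k}\sum_{i=1}^{r}f(\lambda_i)\,\frac{e_{r-1-k}(\widehat{\lambda_i})}{\prod_{j\neq i}(\lambda_i-\lambda_j)},\qquad 0\leq k\leq r-1.$$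
   Context: $\mathscr{P}_n(\mathbb{D})$ is the set of $n\times n$ matrices $A$ over $\mathbb{D}$ that are Hermitian ($A=A^*$, with $A^*$ the conjugate transpose) and positive ($x^*Ax>0$ for all nonzero $x\in\mathbb{D}^n$). $\mathrm{Spec}(X)$ is the set of eigenvalues of $X$ (right eigenvalues $\lambda$, $Xv=v\lambda$ with $v\neq 0$, when $\mathbb{D}=\mathbb{H}$), without multiplicity; for $A,B\in\mathscr{P}_n(\mathbb{D})$ one has $\mathrm{Spec}(A^{-1}B)=\mathrm{Spec}(A^{-1/2}BA^{-1/2})\subset(0,\infty)$. For a continuous $f:(0,\infty)\to\mathbb{R}$ and $X=U\,\mathrm{diag}(\lambda_1,\dots,\lambda_n)\,U^*\in\mathscr{P}_n(\mathbb{D})$ with $UU^*=\mathrm{Id}_n$, set $f(X)=U\,\mathrm{diag}(f(\lambda_1),\dots,f(\lambda_n))\,U^*$. A Kubo-Ando mean on $\mathscr{P}_n(\mathbb{D})$ is a continuous map $\sigma:\mathscr{P}_n(\mathbb{D})\times\mathscr{P}_n(\mathbb{D})\to\mathscr{P}_n(\mathbb{D})$ that is monotone in both arguments for the Loewner order, satisfies $g(A\,\sigma\,B)g^*=(gAg^* )\,\sigma\,(gBg^* )$ for all $g\in\mathrm{GL}_n(\mathbb{D})$, and satisfies $\mathrm{Id}_n\,\sigma\,\mathrm{Id}_n=\mathrm{Id}_n$. By the Kubo-Ando correspondence, used throughout, it is given by $A\,\sigma\,B=A^{1/2}f(A^{-1/2}BA^{-1/2})A^{1/2}$ for a unique operator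 monotone function $f:(0,\infty)\to(0,\infty)$ with $f(1)=1$, called its representing function. $\widehat{\lambda_i}=(\lambda_1,\dots,\lambda_{i-1},\lambda_{i+1},\dots,\lambda_r)\in\mathbb{R}^{r-1}$, and $e_m$ is the elementary symmetric polynomial of degree $m$ in $r-1$ variables, with $e_0=1$. *)

(* Defs.v *)
From HB Require Import structures.
From mathcomp Require Import all_boot all_order all_algebra ring.
From mathcomp Require Import all_classical all_reals all_analysis.
From mathcomp Require Import complex.
From mathcomp Require mpoly.

Set Implicit Arguments.
Unset Strict Implicit.
Unset Printing Implicit Defensive.

Import Order.TTheory GRing.Theory Num.Theory.
Import numFieldNormedType.Exports.

Local Open Scope classical_set_scope.
Local Open Scope ring_scope.

(* Real algebras with a conjugation and a topology.  Only the three instances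
   below are used; the axioms make every nonzero element invertible. *)
HB.mixin Record isStarAlgebra (R : realType) D of GRing.Algebra R D := {
  conjD : D -> D ;
  conjDK : involutive conjD ;
  conjDD : {morph conjD : x y / x + y} ;
  conjDM : forall x y, conjD (x * y) = conjD y * conjD x ;
  conjDZ : forall (a : R) x, conjD (a *: x) = a *: conjD x ;
  conjD_mul_gt0 : forall x, x != 0 ->
    exists2 a : R, 0 < a & conjD x * x = a%:A
}.

#[short(type="starAlgType")]
HB.structure Definition StarAlgebra (R : realType) :=
  {D of isStarAlgebra R D & GRing.Algebra R D & Topological D}.

Section RealInstance.
Variable R : realType.

Let conjr (x : R^o) : R^o := x.

Let conjrM x y : conjr (x * y) = conjr y * conjr x.
Proof. exact: mulrC. Qed.

Let conjr_gt0 (x : R^o) : x != 0 ->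
  exists2 a : R, 0 < a & conjr x * x = a%:A.
Proof.
move=> x0; exists ((x : R) * x); last by rewrite /GRing.scale/= mulr1.
by rewrite -expr2 lt_def sqr_ge0 andbT expf_neq0.
Qed.

HB.instance Definition _ := isStarAlgebra.Build R R^o
  (fun _ => erefl) (fun _ _ => erefl) conjrM (fun _ _ => erefl) conjr_gt0.

End RealInstance.

(* [Rcomplex R] is R[i] seen as an R-algebra. *)
Section ComplexInstance.
Variable R : realType.
Local Notation C := (Rcomplex R).

Let scaleAr (a : R) (x y : C) : a *: (x * y) = x * (a *: y).
Proof. by rewrite mulrC scalerAl mulrC. Qed.

HB.instance Definition _ := GRing.Lalgebra_isAlgebra.Build R C scaleAr.

Definition complex_pair (z : C) : R * R := (complex.Re z, complex.Im z).

HB.instance Definition _ :=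
  Topological.copy C (initial_topology complex_pair).

Let conj (x : C) : C := conjc x.

Let conjK : involutive conj.
Proof. by case=> a b; rewrite /conj/= opprK. Qed.

Let conjD' : {morph conj : x y / x + y}.
Proof. by move=> x y; exact: (rmorphD (@conjc R)). Qed.

Let conjM x y : conj (x * y) = conj y * conj x.
Proof. by rewrite mulrC; exact: (rmorphM (@conjc R)). Qed.

Let conjZ (a : R) x : conj (a *: x) = a *: conj x.
Proof. by case: x => b c; congr Complex; rewrite /= mulrN. Qed.

Let conj_gt0 (x : C) : x != 0 -> exists2 a : R, 0 < a & conj x * x = a%:A.
Proof.
case: x => a b ab0; exists (a ^+ 2 + b ^+ 2).
  rewrite lt_def addr_ge0 ?sqr_ge0// andbT paddr_eq0 ?sqr_ge0// !sqrf_eq0.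
  by apply: contra ab0 => /andP[/eqP-> /eqP->].
by congr Complex; ring.
Qed.

HB.instance Definition _ :=
  isStarAlgebra.Build R C conjK conjD' conjM conjZ conj_gt0.

End ComplexInstance.

(* [Quat a b c d] is a + b i + c j + d k. *)
Record quat (R : Type) := Quat { qre : R; qi : R; qj : R; qk : R }.

Section QuatInstance.
Variable R : realType.
Local Notation H := (quat R).
Implicit Types x y z : H.

Definition quat_tuple x : R * R * R * R := (qre x, qi x, qj x, qk x).
Definition tuple_quat (t : R * R * R * R) : H :=
  Quat t.1.1.1 t.1.1.2 t.1.2 t.2.

Lemma quat_tupleK : cancel quat_tuple tuple_quat. Proof. by case. Qed.

HB.instance Definition _ := Choice.copy H (can_type quat_tupleK).

Definition quat_add x y :=
  Quat (qre x + qre y) (qi x + qi y) (qj x + qj y) (qk x + qk y).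
Definition quat_opp x := Quat (- qre x) (- qi x) (- qj x) (- qk x).
Definition quat_mul x y :=
  let: Quat a b c d := x in let: Quat a' b' c' d' := y in
  Quat (a * a' - b * b' - c * c' - d * d')
       (a * b' + b * a' + c * d' - d * c')
       (a * c' - b * d' + c * a' + d * b')
       (a * d' + b * c' - c * b' + d * a').
Definition quat_scale (a : R) x := Quat (a * qre x) (a * qi x) (a * qj x) (a * qk x).
Definition quat_conj x := Quat (qre x) (- qi x) (- qj x) (- qk x).

Let addqA : associative quat_add.
Proof. by move=> [????] [????] [????]; congr Quat; exact: addrA. Qed.
Let addqC : commutative quat_add.
Proof. by move=> [????] [????]; congr Quat; exact: addrC. Qed.
Let add0q : left_id (Quat 0 0 0 0) quat_add.
Proof. by move=> [????]; congr Quat; exact: add0r. Qed.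
Let addNq : left_inverse (Quat 0 0 0 0) quat_opp quat_add.
Proof. by move=> [????]; congr Quat; exact: addNr. Qed.

HB.instance Definition _ := GRing.isZmodule.Build H addqA addqC add0q addNq.

Let mulqA : associative quat_mul.
Proof. by move=> [????] [????] [????]; congr Quat; ring. Qed.
Let mul1q : left_id (Quat 1 0 0 0) quat_mul.
Proof. by move=> [????]; congr Quat; ring. Qed.
Let mulq1 : right_id (Quat 1 0 0 0) quat_mul.
Proof. by move=> [????]; congr Quat; ring. Qed.
Let mulqDl : left_distributive quat_mul +%R.
Proof. by move=> [????] [????] [????]; congr Quat => /=; ring. Qed.
Let mulqDr : right_distributive quat_mul +%R.
Proof. by move=> [????] [????] [????]; congr Quat => /=; ring. Qed.
Let oneq_neq0 : Quat 1 0 0 0 != 0 :> H.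
Proof. by apply/eqP => -[/eqP]; rewrite oner_eq0. Qed.

HB.instance Definition _ := GRing.Zmodule_isNzRing.Build H
  mulqA mul1q mulq1 mulqDl mulqDr oneq_neq0.

Let scaleqA a b x : quat_scale a (quat_scale b x) = quat_scale (a * b) x.
Proof. by congr Quat; exact: mulrA. Qed.
Let scale1q : left_id 1 quat_scale.
Proof. by case=> *; congr Quat; exact: mul1r. Qed.
Let scaleqDr : right_distributive quat_scale +%R.
Proof. by move=> ? [????] [????]; congr Quat; exact: mulrDr. Qed.
Let scaleqDl x : {morph quat_scale^~ x : a b / a + b}.
Proof. by move=> a b; congr Quat; exact: mulrDl. Qed.

HB.instance Definition _ := GRing.Zmodule_isLmodule.Build R H
  scaleqA scale1q scaleqDr scaleqDl.

Let scaleqAl (a : R) x y : a *: (x * y) = (a *: x) * y.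
Proof. by case: x y => [????] [????]; congr Quat => /=; ring. Qed.
Let scaleqAr (a : R) x y : a *: (x * y) = x * (a *: y).
Proof. by case: x y => [????] [????]; congr Quat => /=; ring. Qed.

HB.instance Definition _ := GRing.Lmodule_isLalgebra.Build R H scaleqAl.
HB.instance Definition _ := GRing.Lalgebra_isAlgebra.Build R H scaleqAr.

HB.instance Definition _ := Topological.copy H (initial_topology quat_tuple).

Let conjqK : involutive quat_conj.
Proof. by case=> *; rewrite /quat_conj/= !opprK. Qed.
Let conjqD : {morph quat_conj : x y / x + y}.
Proof. by move=> [????] [????]; congr Quat => /=; ring. Qed.
Let conjqM x y : quat_conj (x * y) = quat_conj y * quat_conj x.
Proof. by case: x y => [????] [????]; congr Quat => /=; ring. Qed.
Let conjqZ (a : R) x : quat_conj (a *: x) = a *: quat_conj x.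
Proof. by case: x => *; congr Quat => /=; ring. Qed.
Let conjq_gt0 x : x != 0 -> exists2 a : R, 0 < a & quat_conj x * x = a%:A.
Proof.
case: x => a b c d x0; exists (a ^+ 2 + b ^+ 2 + c ^+ 2 + d ^+ 2).
  rewrite lt_def !addr_ge0 ?sqr_ge0// andbT.
  rewrite !paddr_eq0 ?addr_ge0 ?sqr_ge0// !sqrf_eq0.
  by apply: contra x0 => /andP[/andP[/andP[/eqP-> /eqP->] /eqP->] /eqP->].
by congr Quat => /=; ring.
Qed.

HB.instance Definition _ :=
  isStarAlgebra.Build R H conjqK conjqD conjqM conjqZ conjq_gt0.

End QuatInstance.

Variant div_algebra := Reals | Complexes | Quaternions.

Definition dalg (R : realType) (d : div_algebra) : starAlgType R :=
  match d with
  | Reals => R^o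
  | Complexes => Rcomplex R
  | Quaternions => quat R
  end.

Section Matrices.
Variables (R : realType) (D : starAlgType R).

Definition adjm m n (A : 'M[D]_(m, n)) : 'M[D]_(n, m) := map_mx conjD A^T.

Definition hermitian n (A : 'M[D]_n) : Prop := A = adjm A.

Definition qform n (A : 'M[D]_n) (x : 'cV[D]_n) : D :=
  (adjm x *m A *m x) 0 0.

(* Positivity of an element of D includes being real. *)
Definition posdef n (A : 'M[D]_n) : Prop :=
  hermitian A /\
  forall x : 'cV[D]_n, x != 0 -> exists2 a : R, 0 < a & qform A x = a%:A.

Definition possemidef n (A : 'M[D]_n) : Prop :=
  hermitian A /\
  forall x : 'cV[D]_n, exists2 a : R, 0 <= a & qform A x = a%:A.

Definition loewner n (A B : 'M[D]_n) : Prop := possemidef (B - A).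

(* MathComp's [invmx] and [unitmx] require commutative entries. *)
Definition is_mxinv n (A A' : 'M[D]_n) : Prop :=
  A *m A' = 1%:M /\ A' *m A = 1%:M.

Definition in_GL n (g : 'M[D]_n) : Prop := exists g', is_mxinv g g'.

(* The inverse of A, and 0 if A is not invertible. *)
Definition mxinv n (A : 'M[D]_n) : 'M[D]_n := xget 0 [set A' | is_mxinv A A'].

Definition right_spec n (X : 'M[D]_n) : set D :=
  [set l | exists2 v : 'cV[D]_n, v != 0 & X *m v = v *m l%:M].

Definition real_diag n (l : 'rV[R]_n) : 'M[D]_n :=
  diag_mx (map_mx (fun t : R => t%:A) l).

(* f(X) for X = U diag(l) U^*.  The value does not depend on the chosen
   decomposition; it is 0 if there is none. *)
Definition fcalc (f : R -> R) n (X : 'M[D]_n) : 'M[D]_n :=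
  xget 0 [set Y | exists (U : 'M[D]_n) (l : 'rV[R]_n),
    [/\ U *m adjm U = 1%:M,
        X = U *m real_diag l *m adjm U &
        Y = U *m real_diag (map_mx f l) *m adjm U]].

Definition sqrtm n (X : 'M[D]_n) : 'M[D]_n := fcalc Num.sqrt X.

Definition operator_monotone (f : R -> R) : Prop :=
  forall n (X Y : 'M[D]_n), posdef X -> posdef Y ->
    loewner X Y -> loewner (fcalc f X) (fcalc f Y).

(* sigma is only constrained on positive definite arguments. *)
Definition kubo_ando_mean n (sigma : 'M[D]_n -> 'M[D]_n -> 'M[D]_n) : Prop :=
  [/\ forall A B, posdef A -> posdef B -> posdef (sigma A B),
      {within [set AB : 'M[D]_n * 'M[D]_n | posdef AB.1 /\ posdef AB.2],
        continuous (fun AB => sigma AB.1 AB.2)},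
      forall A A' B B', posdef A -> posdef A' -> posdef B -> posdef B' ->
        loewner A A' -> loewner B B' -> loewner (sigma A B) (sigma A' B'),
      forall g A B, in_GL g -> posdef A -> posdef B ->
        g *m sigma A B *m adjm g =
          sigma (g *m A *m adjm g) (g *m B *m adjm g) &
      sigma 1%:M 1%:M = 1%:M].

(* The values of f outside (0, +oo) are irrelevant. *)
Definition representing_function n (sigma : 'M[D]_n -> 'M[D]_n -> 'M[D]_n)
    (f : R -> R) : Prop :=
  [/\ {within `]0, +oo[, continuous f},
      forall t, 0 < t -> 0 < f t,
      operator_monotone f,
      f 1 = 1 &
      forall A B, posdef A -> posdef B ->
        sigma A B =
          sqrtm A *m fcalc f (mxinv (sqrtm A) *m B *m mxinv (sqrtm A))
            *m sqrtm A].

End Matrices.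

(* e_m evaluated at (lam_j)_{j <> i} *)
Definition esym_hat (R : realType) r (lam : 'I_r -> R) (i : 'I_r) (m : nat) : R :=
  mpoly.meval (fun j : 'I_r.-1 => lam (lift i j)) (mpoly.mesym r.-1 R m).

Definition mean_coef (R : realType) (f : R -> R) r (lam : 'I_r -> R) (k : nat) : R :=
  (-1) ^+ (r - 1 - k) *
  \sum_(i < r) f (lam i) *
    (esym_hat lam i (r - 1 - k) / \prod_(j < r | j != i) (lam i - lam j)).

(* Main.v *)
(* Write S = A^(1/2) and X = S^-1 B S^-1, so that A sigma B = S f(X) S.  The
   eigenvalues of X are those of A^-1 B, hence f(X) = p(X) for the Lagrange
   polynomial p = sum_k c_k T^k interpolating f at the lambda_i, and Vieta's
   formulas give the coefficients c_k.  It remains to observe that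
   S X^k S = (B A^-1)^k A.

   The spectral theorem is not needed: [fcalc] is 0 on a matrix without a
   unitary diagonalisation, whereas A sigma B = S f(X) S is positive definite,
   so the factors S and f(X) are nonzero and A and X are diagonalisable. *)
Require Import Defs.
From HB Require Import structures.
From mathcomp Require Import all_boot all_order all_algebra ring.
From mathcomp Require Import all_classical all_reals all_analysis.
From mathcomp Require mpoly.

Set Implicit Arguments.
Unset Strict Implicit.
Unset Printing Implicit Defensive.

Import Order.TTheory GRing.Theory Num.Theory.
Import numFieldNormedType.Exports.

Local Open Scope classical_set_scope.
Local Open Scope ring_scope.

(** * Distinct nodes and Lagrange interpolation *)

(** If [F i = F j] with [i != j], dropping [i] keeps the range, which is then an image of ['I_r.-1]
    and too small. *)
Lemma card_range_inj (T : Type) r (F : 'I_r -> T) :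
  (range F #= `I_r)%card -> injective F.
Proof.
move=> cF i j Fij; apply/eqP/negP => /negP ij.
have r0 : (0 < r)%N by apply: leq_ltn_trans (ltn_ord i).
have FE : range F = range (fun k : 'I_r.-1 => F (lift i k)).
  apply/seteqP; split => _ [k _ <-]; last by exists (lift i k).
  have [k' ->|->] := unliftP i k; first by exists k'.
  have [k' jE|ji] := unliftP i j; last by rewrite ji eqxx in ij.
  by exists k' => //; rewrite -jE.
have : (`I_r #<= `I_r.-1)%card.
  rewrite -(card_le_eql cF) FE (card_le_eqr card_II).
  exact: card_image_le.
by rewrite card_le_II leqNgt ltn_predL r0.
Qed.

(** Vieta's formulas for the numerator of the i-th Lagrange basis polynomial. *)
Lemma prod_subX_esym_hat (R : realType) r (lam : 'I_r -> R) (i : 'I_r) (t : R) :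
  \sum_(k < r) (-1) ^+ (r - 1 - k) * esym_hat lam i (r - 1 - k) * t ^+ k =
  \prod_(j < r | j != i) (t - lam j).
Proof.
case: r => [|r] in lam i *; first by case: i.
pose cs := [tuple lam (lift i j) | j < r].
pose p := \prod_(c <- cs) ('X - c%:P).
have szp : size p = r.+1 by rewrite size_prod_XsubC size_tuple.
transitivity p.[t].
  rewrite horner_coef szp; apply: eq_bigr => k _; congr (_ * _).
  (* [mroots_coeff] is indexed by codegree, so coefficient [k] is read off at [r.+1 - 1 - k]. *)
  have lek : (r.+1 - 1 - k < r.+1)%N by rewrite subn1 ltnS leq_subr.
  have := mpoly.mroots_coeff cs (Ordinal lek).
  rewrite /= subn1 subKn -/p => [->|]; last by rewrite -ltnS.
  congr (_ * _); rewrite /esym_hat; congr (mpoly.meval _ _); apply/funext => j.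
  by rewrite tnth_mktuple.
rewrite /p horner_prod big_tuple /=.
under eq_bigr => j _ do rewrite tnth_mktuple hornerXsubC.
rewrite [RHS](reindex_omap (lift i) (unlift i)) /=; last first.
  by move=> j; rewrite eq_sym => /unlift_some[k jE ->] /=; rewrite -jE.
by apply: eq_bigl => j; rewrite eq_sym neq_lift liftK eqxx.
Qed.

(** Exchanging the two sums gives the Lagrange form. At [lam l] every term with [i != l] has the
    zero factor [j = l]; injectivity makes the denominator of the remaining term nonzero. *)
Lemma mean_coef_interpolates (R : realType) (f : R -> R) r (lam : 'I_r -> R)
    (l : 'I_r) : injective lam ->
  \sum_(k < r) mean_coef f lam k * lam l ^+ k = f (lam l).
Proof.
move=> lam_inj; rewrite /mean_coef.
transitivity (\sum_(i < r) f (lam i) / \prod_(j < r | j != i) (lam i - lam j) *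
    \prod_(j < r | j != i) (lam l - lam j)).
  under [RHS]eq_bigr => i _ do
    rewrite -(prod_subX_esym_hat lam i (lam l)) mulr_sumr.
  rewrite exchange_big; apply: eq_bigr => k _ /=.
  rewrite mulr_sumr mulr_suml; apply: eq_bigr => i _.
  by ring.
rewrite (bigD1 l) //= [X in _ + X]big1 ?addr0 => [|i il].
  rewrite divfK //; apply/prodf_neq0 => j jl.
  by rewrite subr_eq0; apply: contra jl => /eqP/lam_inj->.
by rewrite [X in _ * X](bigD1 l) 1?eq_sym //= subrr mul0r mulr0.
Qed.

(** * Conjugation and inverses in a star algebra *)

Section StarAlgebraMatrices.
Variables (R : realType) (D : starAlgType R).
Local Notation real_diag := (@real_diag R D _).

Lemma conjD0 : conjD (0 : D) = 0.
Proof. by apply: (addrI (conjD 0)); rewrite -conjDD !addr0. Qed.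

Lemma conjD1 : conjD (1 : D) = 1.
Proof. by rewrite -[LHS]mulr1 -{2}(conjDK 1) -conjDM mulr1 conjDK. Qed.

Lemma conjD_sum I (s : seq I) (P : pred I) (F : I -> D) :
  conjD (\sum_(i <- s | P i) F i) = \sum_(i <- s | P i) conjD (F i).
Proof. exact: (big_morph _ conjDD conjD0). Qed.

Lemma star_mulVr (x : D) : x != 0 -> exists y, y * x = 1.
Proof.
move=> /conjD_mul_gt0[a a0 xa]; exists (a^-1 *: conjD x).
by rewrite -scalerAl xa scalerA mulVf ?scale1r // gt_eqF.
Qed.

Lemma star_mulr_eq0 (x y : D) : x != 0 -> x * y = 0 -> y = 0.
Proof.
by move=> /star_mulVr[z zx] xy; rewrite -[y]mul1r -zx -mulrA xy mulr0.
Qed.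

Lemma star_mulrV (x : D) : x != 0 -> exists y, x * y = 1.
Proof.
move=> x0; have [y yx] := star_mulVr x0; exists y.
apply/eqP; rewrite -subr_eq0; apply/eqP.
(* The left inverse [y] is nonzero, so it can be cancelled from [y * (x * y - 1) = 0]. *)
have y0 : y != 0.
  by apply: contra_eq_neq yx => ->; rewrite mul0r eq_sym oner_neq0.
by apply: (star_mulr_eq0 y0); rewrite mulrBr mulrA yx mul1r mulr1 subrr.
Qed.

(** * Linear systems and one-sided inverses without commutativity *)

(** Gaussian elimination by induction on the rows: a zero first row is dropped, and a nonzero entry
    in it serves as pivot to eliminate one unknown. *)
Lemma wide_mx_kernel n m (A : 'M[D]_(n, m)) : (n < m)%N ->
  exists2 x : 'cV[D]_m, x != 0 & A *m x = 0.
Proof.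
elim: n m A => [|n IH] m A lt_nm.
  exists (const_mx 1); last by apply/matrixP => -[].
  apply/negP => /eqP/colP/(_ (Ordinal lt_nm)); rewrite !mxE => /eqP.
  by rewrite oner_eq0.
have [A0|] := pselect (forall j, A 0 j = 0).
  have [x x0 Ax] := IH m (row' 0 A) (ltnW lt_nm).
  exists x => //; apply/matrixP => i k; rewrite !mxE.
  have [i' ->|->] := unliftP 0 i.
    have /matrixP/(_ i' k) := Ax; rewrite !mxE => eq0; apply: etrans eq0.
    by apply: eq_bigr => j _; rewrite !mxE.
  by rewrite big1 // => j _; rewrite A0 mul0r.
move=> /existsNP[j /eqP Aj].
have [b Ab] := star_mulrV Aj.
(* Column k of C is e_(lift j k) corrected along e_j so that the first row of
   A *m C vanishes. *)
pose C : 'M[D]_(m, m.-1) := \matrix_(i, k)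
  ((i == lift j k)%:R - (i == j)%:R * (b * A 0 (lift j k))).
have AC0 k : (A *m C) 0 k = 0.
  rewrite mxE; under eq_bigr => i _ do rewrite mxE mulrBr.
  rewrite sumrB (bigD1 (lift j k)) //= eqxx mulr1 big1 ?addr0; last first.
    by move=> i /negbTE->; rewrite mulr0.
  rewrite (bigD1 j) //= eqxx mul1r mulrA Ab mul1r big1 ?addr0 ?subrr //.
  by move=> i /negbTE->; rewrite mul0r mulr0.
have [|y y0 ACy] := IH m.-1 (row' 0 (A *m C)).
  by rewrite -ltnS prednK // (leq_trans _ lt_nm).
exists (C *m y).
  (* [C] is injective: entry [lift j k] of [C *m y] is entry [k] of [y]. *)
  apply: contra_neq y0 => Cy; apply/colP => k.
  have /colP/(_ (lift j k)) := Cy; rewrite !mxE => eq0; apply: etrans eq0.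
  rewrite (bigD1 k) //= mxE eqxx [lift j k == j]eq_sym.
  rewrite (negbTE (neq_lift _ _)) mul0r subr0 mul1r big1 ?addr0 // => i ik.
  rewrite mxE [lift j k == j]eq_sym (negbTE (neq_lift _ _)) mul0r subr0.
  by rewrite (inj_eq lift_inj) eq_sym (negbTE ik) mul0r.
rewrite mulmxA; apply/matrixP => i k; rewrite [RHS]mxE.
have [i' ->|->] := unliftP 0 i.
  have /matrixP/(_ i' k) := ACy; rewrite !mxE => eq0; apply: etrans eq0.
  by apply: eq_bigr => l _; rewrite !mxE.
by rewrite mxE big1 // => l _; rewrite AC0 mul0r.
Qed.

Lemma star_mulmx1C n (U V : 'M[D]_n) : U *m V = 1%:M -> V *m U = 1%:M.
Proof.
move=> UV.
(* If U x = 0 with x != 0, then row_mx V x would be a wide injective matrix. *)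
have Uinj (x : 'cV[D]_n) : U *m x = 0 -> x = 0.
  move=> Ux; apply/eqP/negP => /negP x0.
  have [] := @wide_mx_kernel n (n + 1) (row_mx V x); first by rewrite addn1.
  move=> z; rewrite -[z]vsubmxK mul_row_col.
  set y := usubmx z; set c := dsubmx z => z0 Vz.
  (* From [V y + x c = 0] follows [y = U V y = - U x c = 0]. Then [x c = 0] with [c] an invertible
     scalar, so [x = 0]. *)
  have y0 : y = 0.
    by rewrite -[y]mul1mx -UV -mulmxA -[V *m y](addrK (x *m c)) Vz sub0r
      mulmxN mulmxA Ux mul0mx oppr0.
  move: Vz; rewrite y0 mulmx0 add0r => xc.
  have c0 : c != 0.
    by apply: contra z0 => /eqP c0; rewrite y0 c0 col_mx0.
  have c00 : c 0 0 != 0.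
    apply: contra c0 => /eqP c00; apply/eqP/matrixP => i k.
    by rewrite !ord1 c00 mxE.
  case/negP: x0; apply/eqP/colP => i.
  have [d cd] := star_mulrV c00.
  have /matrixP/(_ i 0) := xc; rewrite !mxE big_ord1 => xci.
  by rewrite -[LHS]mulr1 -cd mulrA xci mul0r.
(* [U (V U - 1) = 0], so injectivity of [U] kills each column of [V U - 1]. *)
apply/eqP; rewrite -subr_eq0; apply/eqP/matrixP => i j.
have /matrixP/(_ i 0) : col j (V *m U - 1%:M) = 0.
  apply: Uinj; rewrite colE mulmxA mulmxBr mulmxA UV mul1mx mulmx1 subrr.
  exact: mul0mx.
by rewrite !mxE.
Qed.

Lemma mxinvE n (A A' : 'M[D]_n) : A *m A' = 1%:M -> mxinv A = A'.
Proof.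
move=> AA'; have A'A := star_mulmx1C AA'.
have [/= AB _] : is_mxinv A (mxinv A) by apply: xgetPex; exists A'.
by rewrite -[LHS]mul1mx -A'A -mulmxA AB mulmx1.
Qed.

(** * Real diagonal matrices and functional calculus *)

(** Real scalars are central in [D], even when [D] is not commutative. *)
Lemma scale_algmxAr m n p (c : R) (A : 'M[D]_(m, n)) (B : 'M[D]_(n, p)) :
  A *m (c%:A *: B) = c%:A *: (A *m B).
Proof.
apply/matrixP => i j; rewrite !mxE mulr_sumr; apply: eq_bigr => k _.
by rewrite mxE !mulr_algl scalerAr.
Qed.

Lemma adjm_mul m n p (A : 'M[D]_(m, n)) (B : 'M[D]_(n, p)) :
  adjm (A *m B) = adjm B *m adjm A.
Proof.
apply/matrixP => i j; rewrite !mxE conjD_sum; apply: eq_bigr => k _.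
by rewrite !mxE conjDM.
Qed.

Lemma real_diagM n (l m : 'rV[R]_n) :
  real_diag l *m real_diag m = real_diag (\row_i (l 0 i * m 0 i)).
Proof.
rewrite mul_diag_mx; apply/matrixP => i j; rewrite !mxE.
by rewrite mulrnAr mulr_algl scalerA.
Qed.

Lemma real_diag1 n : real_diag (const_mx 1 : 'rV[R]_n) = 1%:M.
Proof. by apply/matrixP => i j; rewrite !mxE scale1r. Qed.

Lemma real_diag_delta n (l : 'rV[R]_n) i :
  real_diag l *m delta_mx i 0 = (l 0 i)%:A *: delta_mx i (0 : 'I_1).
Proof.
rewrite mul_diag_mx; apply/matrixP => j k; rewrite !mxE.
by have [->|] := eqVneq j i; rewrite ?mulr0.
Qed.

Lemma real_diag_sum n r (c : 'I_r -> R) (l : 'I_r -> 'rV[R]_n) :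
  real_diag (\sum_k c k *: l k) = \sum_k (c k)%:A *: real_diag (l k).
Proof.
apply/matrixP => i j; rewrite !mxE !summxE scaler_suml -sumrMnl.
by apply: eq_bigr => k _; rewrite !mxE mulr_algl -scalerMnr scalerA.
Qed.

Lemma delta_neq0 n (i : 'I_n) : delta_mx i 0 != 0 :> 'cV[D]_n.
Proof.
apply/eqP => /colP/(_ i); rewrite !mxE !eqxx => /eqP.
by rewrite oner_eq0.
Qed.

Lemma mulmx_delta_neq0 n (V W : 'M[D]_n) (i : 'I_n) :
  W *m V = 1%:M -> V *m delta_mx i 0 != 0 :> 'cV[D]_n.
Proof.
move=> WV; apply: contra_neq (delta_neq0 i) => Vi.
by rewrite -[LHS]mul1mx -WV -mulmxA Vi mulmx0.
Qed.

(** A value other than the default 0 of [xget] certifies that a unitary diagonalisation exists. *)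
Lemma fcalc_neq0 (f : R -> R) n (X : 'M[D]_n) : fcalc f X != 0 ->
  exists U (l : 'rV[R]_n), [/\ U *m adjm U = 1%:M, adjm U *m U = 1%:M,
    X = U *m real_diag l *m adjm U &
    fcalc f X = U *m real_diag (map_mx f l) *m adjm U].
Proof.
rewrite /fcalc; case: xgetP => [Y _ [U [l [UU XE YE]]] _|_ /eqP//].
by exists U, l; split => //; exact: star_mulmx1C.
Qed.

(** The quadratic form of [A] at the i-th column of [U] equals [l 0 i]. *)
Lemma posdef_eigenvalue_gt0 n (A U : 'M[D]_n) (l : 'rV[R]_n) i : posdef A ->
  adjm U *m U = 1%:M -> A = U *m real_diag l *m adjm U -> 0 < l 0 i.
Proof.
move=> [_ Apos] UU AE; have [a a0] := Apos _ (mulmx_delta_neq0 i UU).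
rewrite /qform adjm_mul AE !mulmxA -[_ *m adjm U *m U]mulmxA UU mulmx1.
rewrite -[_ *m adjm U *m U]mulmxA UU mulmx1 -mulmxA real_diag_delta.
rewrite scale_algmxAr mxE mulr_algl mxE (bigD1 i) //= big1 ?addr0; last first.
  by move=> j ji; rewrite !mxE (negbTE ji) mulr0.
rewrite !mxE !eqxx conjD1 mulr1 => /eqP.
rewrite -subr_eq0 -scalerBl scaler_eq0 oner_eq0 orbF subr_eq0.
by move=> /eqP->.
Qed.

Lemma posdef_neq0 n (A : 'M[D]_n) : (0 < n)%N -> posdef A -> A != 0.
Proof.
move=> n0 [_ Apos]; apply/eqP => A0.
have [a a0] := Apos _ (delta_neq0 (Ordinal n0)).
rewrite /qform A0 mulmx0 mul0mx mxE => /esym/eqP.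
by rewrite scaler_eq0 oner_eq0 orbF gt_eqF.
Qed.

Lemma unitary_conj_exp n (U W : 'M[D]_n) (l : 'rV[R]_n) k : U *m W = 1%:M ->
  W *m U = 1%:M ->
  (U *m real_diag l *m W) ^+ k = U *m real_diag (map_mx (fun t => t ^+ k) l) *m W.
Proof.
move=> UW WU; elim: k => [|k IH].
  rewrite expr0; have -> : map_mx (fun t => t ^+ 0) l = const_mx 1.
    by apply/matrixP => i j; rewrite !mxE.
  by rewrite real_diag1 mulmx1 UW.
rewrite exprS IH -[LHS]/(_ *m _) !mulmxA -[_ *m W *m U]mulmxA WU mulmx1.
rewrite -[U *m _ *m _]mulmxA real_diagM; congr (_ *m real_diag _ *m _).
by apply/rowP => i; rewrite !mxE exprS.
Qed.

End StarAlgebraMatrices.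

Theorem theorem4p4 (R : realType) (d : div_algebra) (n r : nat)
  (sigma : 'M[dalg R d]_n -> 'M[dalg R d]_n -> 'M[dalg R d]_n) (f : R -> R)
  (A B : 'M[dalg R d]_n) (lam : 'I_r -> R)
  (hsigma : kubo_ando_mean sigma)
  (hf : representing_function sigma f)
  (hA : posdef A) (hB : posdef B)
  (hcard : (right_spec (mxinv A *m B) #= `I_r)%card)
  (hspec : right_spec (mxinv A *m B) = range (fun i : 'I_r => (lam i)%:A)) :
  sigma A B =
    (mean_coef f lam 0)%:A *: A +
    \sum_(1 <= k < r)
      (mean_coef f lam k)%:A *: ((B *m mxinv A) ^+ (k - 1) *m B).
Proof.
(* For [n = 0] all matrices agree; for [n > 0] a positive definite matrix is nonzero. *)
have [nz|n0] := posnP n.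
  by apply/matrixP => i; have := ltn_ord i; rewrite [X in (_ < X)%N]nz.
have lam_inj : injective lam.
  by rewrite hspec in hcard => i j ij; apply: (card_range_inj hcard); rewrite ij.
have [sigma_pos _ _ _ _] := hsigma; have [_ _ _ _ sigmaE] := hf.
have := posdef_neq0 n0 (sigma_pos _ _ hA hB); rewrite sigmaE //.
set S := sqrtm A; set X := mxinv S *m B *m mxinv S => SFS0.
have S0 : S != 0 by apply: contra_neq SFS0 => ->; rewrite mulmx0.
have F0 : fcalc f X != 0.
  by apply: contra_neq SFS0 => ->; rewrite mulmx0 mul0mx.
have [U [l [UU' U'U AE SE]]] := fcalc_neq0 S0; rewrite -/(sqrtm A) -/S in SE.
have [V [m [VV' V'V XE FE]]] := fcalc_neq0 F0.
(* Positive eigenvalues make [Num.sqrt] a genuine square root with nonzero values, so [S] squares to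
   [A] and is invertible. *)
have l_gt0 i : 0 < l 0 i := posdef_eigenvalue_gt0 i hA U'U AE.
have SS : S *m S = A.
  rewrite -[LHS]/(S ^+ 2) SE unitary_conj_exp // [RHS]AE.
  congr (_ *m real_diag _ _ *m _); apply/rowP => i.
  by rewrite !mxE sqr_sqrtr // ltW.
have [S' SS'] : exists S', S *m S' = 1%:M.
  exists (U *m real_diag _ (map_mx (fun t => (Num.sqrt t)^-1) l) *m adjm U).
  rewrite SE !mulmxA -[_ *m adjm U *m U]mulmxA U'U mulmx1.
  rewrite -[U *m _ *m _]mulmxA real_diagM -[RHS]UU' -[X in _ = X *m _]mulmx1.
  rewrite -real_diag1; congr (_ *m real_diag _ _ *m _).
  by apply/rowP => i; rewrite !mxE divff // gt_eqF // sqrtr_gt0.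
have S'S := star_mulmx1C SS'.
have S'E : mxinv S = S' := mxinvE SS'.
have A'E : mxinv A = S' *m S'.
  by apply: mxinvE; rewrite -SS mulmxA -[_ *m S *m S']mulmxA SS' mulmx1.
have m_lam i : exists j, lam j = m 0 i.
  have : right_spec (mxinv A *m B) (m 0 i)%:A.
    (* Since [A^-1 B S' = S' X], the map [S'] carries the eigenvector [V e_i] of [X] to one of
       [A^-1 B]. *)
    exists (S' *m V *m delta_mx i 0).
      apply: (@mulmx_delta_neq0 _ _ _ _ (adjm V *m S)).
      by rewrite mulmxA -[_ *m S *m S']mulmxA SS' mulmx1.
    rewrite A'E -scalemx1 scale_algmxAr mulmx1.
    have -> : S' *m S' *m B *m (S' *m V *m delta_mx i 0) =
        S' *m (X *m V) *m delta_mx i (0 : 'I_1) by rewrite /X S'E !mulmxA.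
    by rewrite XE -!mulmxA [adjm V *m _]mulmxA V'V mul1mx real_diag_delta
      !scale_algmxAr.
  rewrite hspec => -[j _ /eqP]; rewrite -subr_eq0 -scalerBl scaler_eq0.
  by rewrite oner_eq0 orbF subr_eq0 => /eqP ?; exists j.
(* Every diagonal entry of [m], repeated or not, is a node, so the interpolating polynomial agrees
   with [f] there. *)
have FX : fcalc f X = \sum_(k < r) (mean_coef f lam k)%:A *: X ^+ k.
  rewrite FE; have -> : map_mx f m =
      \sum_(k < r) mean_coef f lam k *: map_mx (fun t => t ^+ k) m.
    apply/rowP => i; rewrite summxE mxE; have [j mj] := m_lam i.
    rewrite -{1}mj -mean_coef_interpolates //; apply: eq_bigr => k _.
    by rewrite !mxE mj.
  rewrite real_diag_sum mulmx_sumr mulmx_suml; apply: eq_bigr => k _.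
  by rewrite scale_algmxAr -scalemxAl XE unitary_conj_exp.
(* Induction using [S X = B S' = B A^-1 S]. *)
have SXS k : S *m X ^+ k *m S = (B *m mxinv A) ^+ k *m A.
  elim: k => [|k IH]; first by rewrite !expr0 mulmx1 mul1mx SS.
  rewrite !exprS -[X * _]/(X *m _) -[(_ *m _) * _]/(_ *m _) -[RHS]mulmxA -IH.
  by rewrite A'E /X S'E !mulmxA SS' mul1mx -[_ *m S' *m S]mulmxA S'S mulmx1.
(* As [n > 0], there is an eigenvalue, so the term [k = 0] exists and can be split off. *)
have r0 : (0 < r)%N.
  by have [j _] := m_lam (Ordinal n0); apply: leq_ltn_trans (ltn_ord j).
rewrite FX mulmx_sumr mulmx_suml.
under eq_bigr => k _ do rewrite scale_algmxAr -scalemxAl SXS.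
rewrite -(big_mkord xpredT (fun k => (mean_coef f lam k)%:A *:
  ((B *m mxinv A) ^+ k *m A))) big_ltn // expr0 mul1mx; congr (_ + _).
(* For positive exponents, the last factor [A^-1] cancels against [A] and leaves a trailing [B]. *)
apply: eq_big_nat => -[//|k] _; congr (_ *: _).
have A'A : mxinv A *m A = 1%:M.
  by rewrite A'E -SS !mulmxA -[_ *m S' *m S]mulmxA S'S mulmx1 S'S.
by rewrite subn1 /= exprSr -[_ ^+ k * _]/(_ *m _) -!mulmxA A'A mulmx1.
Qed.
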